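(* Suppose that $\theta$ is an infinite regular cardinal. (1) If $\kappa=\mathfrak b_\theta$ and $\mathrm{onto}(J^{\mathrm{bd}}[\theta],\theta)$ holds, then so does $\mathrm{onto}^+(\{\theta\},\mathcal J^\kappa_{\theta^+},\theta)$; (2) If $\kappa=\mathfrak b_\theta=\theta^+$ and $\mathrm{onto}(J^{\mathrm{bd}}[\theta],\theta)$ holds, then so does $\mathrm{onto}^+(\{\theta\},\mathcal J^\kappa_\kappa,\kappa)$; (3) If $\kappa=\mathfrak d_\theta$, then $\mathrm{onto}^+(\mathcal J^\kappa_{\theta^+},\theta)$ holds; (4) If $\kappa=\mathfrak d_\theta$ and $\mathfrak b_\theta>\theta^+$, then $\mathrm{unbounded}^+(\mathcal J^\kappa_{\theta^+},\theta^+)$ implies $\mathrm{onto}^+(\mathcal J^\kappa_{\theta^+},\theta^+)$.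
   Context: For an infinite cardinal $\kappa$: an ideal over $\kappa$ is a nonempty family $J$ of subsets of $\kappa$ closed under subsets and finite unions; it is $\nu$-complete if it is closed under unions of fewer than $\nu$ of its members; $J^+:=\mathcal P(\kappa)\setminus J$. $J^{\mathrm{bd}}[\kappa]$ is the ideal of bounded subsets of $\kappa$. $\mathcal J^\kappa_\nu$ is the collection of all $\nu$-complete ideals over $\kappa$ extending $J^{\mathrm{bd}}[\kappa]$. $[\kappa]^2$ is identified with the set of pairs $(\alpha,\beta)$ with $\alpha<\beta<\kappa$. A colouring $c:[\kappa]^2\to\vartheta$ is upper-regressive if $c(\alpha,\beta)<\beta$ for all $\alpha<\beta<\kappa$. Let $J$ be an ideal over $\kappa$, $\nu\le\kappa$ an infinite cardinal and $\vartheta$ a cardinal with $2\le\vartheta\le\kappa$. - $\mathrm{onto}(J,\vartheta)$: there is $c:[\kappa]^2\to\vartheta$ such that for every $B\in J^+$ there is $\eta<\kappa$ with $\{c(\eta,\beta)\mid\beta\in B,\ \beta>\eta\}=\vartheta$. (In particular $\mathrm{onto}(J^{\mathrm{bd}}[\theta],\theta)$ concerns colourings $c:[\theta]^2\to\theta$.) - $\mathrm{onto}^+(\{\nu\},J,\vartheta)$: there is $c:[\kappa]^2\to\vartheta$ such that for every $B\in J^+$ there is $\eta<\nu$ such that for every $\tau<\vartheta$, $\{\beta\in B\setminus(\eta+1)\mid c(\eta,\beta)=\tau\}\in J^+$. - $\mathrm{unbounded}^+(\{\nu\},J,\vartheta)$: there is an upper-regressive $c:[\kappa]^2\to\vartheta$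 such that for every $B\in J^+$ there is $\eta<\nu$ such that $\mathrm{otp}(\{\tau<\vartheta\mid\{\beta\in B\setminus(\eta+1)\mid c(\eta,\beta)=\tau\}\in J^+\})=\vartheta$. If $\{\nu\}$ is omitted, then $\nu=\kappa$ is meant. If $J$ is replaced by a collection $\mathcal J$ of ideals over $\kappa$, the principle asserts that one single colouring witnesses the corresponding principle for all $J\in\mathcal J$ simultaneously. For $f,g\in{}^\theta\theta$, $f<^*g$ means that $\{i<\theta\mid f(i)\ge g(i)\}$ is bounded in $\theta$; $\mathfrak b_\theta$ is the least size of an unbounded family in $({}^\theta\theta,<^* )$, and $\mathfrak d_\theta$ is the least size of a cofinal (dominating) family in $({}^\theta\theta,<^* )$. *)

(* Defs.v *)
From mathcomp Require Import all_boot all_order.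
From mathcomp Require Import boolp classical_sets functions cardinality.
From mathcomp Require wochoice.

Set Implicit Arguments.
Unset Strict Implicit.
Unset Printing Implicit Defensive.

Import Order.TTheory.
Local Open Scope classical_set_scope.
Local Open Scope card_scope.
Local Open Scope order_scope.

(* Ordinals are the elements of an arbitrary well-ordered type [O], and an
   ordinal [a] is identified with the set [below a] of the smaller ones.  Any
   given set of ordinals can be found in some such [O] (take a large enough
   initial segment of the ordinals), so that a statement quantified over all
   well-ordered [O] is a statement about all ordinals.  Relations between
   ordinals (such as [c a b < b] below) are then literally those of [O]. *)

Section Ordinals.
Context {d : Order.disp_t} {O : orderType d}.
Implicit Types (a b i eta tau kappa lambda mu nu theta vtheta : O)
  (A B : set O) (J : set (set O)).

Definition below a : set O := [set x | x < a].

Definition cardinal kappa : Prop :=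
  forall a, a < kappa -> ~ (below kappa #= below a).

Definition infinite_cardinal kappa : Prop :=
  cardinal kappa /\ infinite_set (below kappa).

Definition is_succ_cardinal theta lambda : Prop :=
  [/\ cardinal lambda, theta < lambda
    & forall mu, cardinal mu -> theta < mu -> lambda <= mu].

(* [kappa] is the least cardinality of a set satisfying [P]. *)
Definition is_least_size T (P : set T -> Prop) kappa : Prop :=
  [/\ cardinal kappa,
      exists2 F : set T, P F & F #= below kappa
    & forall F : set T, P F -> below kappa #<= F].

Definition bounded_in kappa A : Prop :=
  A `<=` below kappa /\ exists2 a, a < kappa & forall x, A x -> x <= a.

Definition cofinal_in kappa A : Prop :=
  A `<=` below kappa /\ forall a, a < kappa -> exists2 x, A x & a <= x.

Definition is_cofinality kappa lambda : Prop :=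
  is_least_size (cofinal_in kappa) lambda.

Definition infinite_regular theta : Prop :=
  infinite_cardinal theta /\ is_cofinality theta theta.

Definition has_otp A a : Prop :=
  exists2 f : O -> O, set_bij A (below a) f
    & forall x y, A x -> A y -> (f x < f y) = (x < y).

Section Bounding.
Variable theta : O.
Implicit Types (f g : below theta -> below theta)
  (F : set (below theta -> below theta)).

Definition lt_star f g : Prop :=
  bounded_in theta [set \val i | i in [set i | \val (g i) <= \val (f i)]].

Definition unbounded_family F : Prop :=
  ~ exists g, forall f, F f -> lt_star f g.

Definition dominating_family F : Prop :=
  forall g, exists2 f, F f & lt_star g f.

Definition is_bounding_number kappa : Prop :=
  is_least_size unbounded_family kappa.

Definition is_dominating_number kappa : Prop :=
  is_least_size dominating_family kappa.

End Bounding.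

Definition ideal_over kappa J : Prop :=
  [/\ J !=set0,
      forall A, J A -> A `<=` below kappa,
      forall A B, A `<=` B -> J B -> J A
    & forall A B, J A -> J B -> J (A `|` B)].

Definition complete_ideal nu J : Prop :=
  forall F : set (set O), F `<=` J ->
    F #<= below nu -> ~ (F #= below nu) -> J (\bigcup_(A in F) A).

Definition positive kappa J : set (set O) :=
  [set B | B `<=` below kappa /\ ~ J B].

Definition Jbd kappa : set (set O) := [set A | bounded_in kappa A].

Definition complete_ideals kappa nu : set (set (set O)) :=
  [set J | [/\ ideal_over kappa J, complete_ideal nu J & Jbd kappa `<=` J]].

(* Only the values [c a b] with [a < b < kappa] are meaningful. *)
Definition colouring kappa vtheta (c : O -> O -> O) : Prop :=
  forall a b, a < b -> b < kappa -> c a b < vtheta.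

Definition upper_regressive kappa (c : O -> O -> O) : Prop :=
  forall a b, a < b -> b < kappa -> c a b < b.

(* { b in B \ (eta + 1) | c eta b = tau } *)
Definition colour_fibre (c : O -> O -> O) B eta tau : set O :=
  [set b | [/\ B b, eta < b & c eta b = tau]].

Definition onto kappa J vtheta : Prop :=
  exists2 c, colouring kappa vtheta c &
    forall B, positive kappa J B ->
      exists2 eta, eta < kappa &
        [set c eta b | b in [set b | B b /\ eta < b]] = below vtheta.

Definition onto_plus kappa nu (JJ : set (set (set O))) vtheta : Prop :=
  exists2 c, colouring kappa vtheta c &
    forall J, JJ J -> forall B, positive kappa J B ->
      exists2 eta, eta < nu &
        forall tau, tau < vtheta ->
          positive kappa J (colour_fibre c B eta tau).

Definition unbounded_plus kappa nu (JJ : set (set (set O))) vtheta : Prop :=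
  exists c, [/\ colouring kappa vtheta c, upper_regressive kappa c &
    forall J, JJ J -> forall B, positive kappa J B ->
      exists2 eta, eta < nu &
        has_otp [set tau | tau < vtheta /\
                   positive kappa J (colour_fibre c B eta tau)] vtheta].

End Ordinals.

(* Main.v *)
(* If [g_b], [b < kappa], are functions from theta to theta such that every [g]
   fails to bound [g_b] for all large [b], then for each [J]-positive [B] some
   coordinate [i] takes, on positive subsets of [B], unboundedly many values
   [g_b i]: otherwise theta^+-completeness would give a function bounding [g_b]
   for positively many [b].  An unbounded family of size b_theta, or a dominating
   one of size d_theta, yields such [g_b].
   To get all colours it remains to map the unbounded set of values onto theta:
   in (1) by the given colouring of theta; in (3) by cutting theta into intervals
   according to a member of the dominating family, each of which (from some point
   on) meets the set of values.
   In (2) and (4) an enumeration of each ordinal below theta^+ by theta turns the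
   theta colours obtained inside a positive set labelled [s] into all colours
   below [s].  If theta many indices all failed, the missed colours would be
   bounded below theta^+ by a single label [s], a contradiction.  For (4) the
   labels come from the given colouring, and theta^+ < b_theta lets one interval
   partition serve all labels at once. *)
From HB Require Import structures.
Require Import Defs.
From mathcomp Require Import all_boot all_order.
From mathcomp Require Import boolp classical_sets functions cardinality.
From mathcomp Require wochoice.
Local Open Scope order_scope.

Set Implicit Arguments.
Unset Strict Implicit.
Unset Printing Implicit Defensive.
Import Order.TTheory.

(** * Cardinal comparisons as injections and surjections given by total functions *)

Section Cardinality.
Local Open Scope classical_set_scope.
Local Open Scope card_scope.
Context {T U : Type}.
Implicit Types (A : set T) (B : set U).

(** The point [u0] equips [U] with the pointed structure under which the injection extends to a
    total function. *)
Lemma card_le_inj A B (u0 : U) : A #<= B ->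
  exists f : T -> U, (forall x, A x -> B (f x)) /\
    forall x y, A x -> A y -> f x = f y -> x = y.
Proof.
pose hU := isPointed.Build U u0.
pose V : pointedType := HB.pack U hU (gen_eqMixin U) (gen_choiceMixin U).
move=> /(@pcard_leP T V A B)[f]; exists f; split; first exact: (@funS _ _ _ _ f).
by move=> x y Ax Ay; apply: (@inj _ _ _ f); apply/mem_set.
Qed.

Lemma card_le_of_inj A B (f : T -> U) : (forall x, A x -> B (f x)) ->
  (forall x y, A x -> A y -> f x = f y -> x = y) -> A #<= B.
Proof.
move=> AB f_inj.
have /card_eqPle[_ Af] : f @` A #= A.
  by apply: inj_card_eq => x y; rewrite !inE; exact: f_inj.
apply: card_le_trans Af _.
by apply: subset_card_le => _ [x Ax <-]; exact: AB.
Qed.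

Lemma card_le_of_surj A B (f : U -> T) :
  (forall x, A x -> exists2 y, B y & f y = x) -> A #<= B.
Proof.
move=> f_surj; apply: card_le_trans (card_image_le f B).
by apply: subset_card_le => x /f_surj[y By <-]; exists y.
Qed.

Lemma card_le_surj A B (u0 : U) : B #<= A ->
  exists f : T -> U, forall y, B y -> exists2 x, A x & f x = y.
Proof.
pose hU := isPointed.Build U u0.
pose V : pointedType := HB.pack U hU (gen_eqMixin U) (gen_choiceMixin U).
by move=> /(@pcard_surjP V T B A)[f fP]; exists f.
Qed.
End Cardinality.

(** * Adding a point to an infinite set, and products *)

Section CardinalArithmetic.
Local Open Scope classical_set_scope.
Local Open Scope card_scope.

Lemma infinite_setU1 {T : Type} (A : set T) (a : T) :
  infinite_set A -> A `|` [set a] #<= A.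
Proof.
have [Aa _|Aa] := pselect (A a).
  by apply: subset_card_le => x [//|->].
move=> /infiniteP Ainf; have [x0 Ax0] : A !=set0.
  by apply: infinite_setN0; apply/infiniteP.
have [f [fA f_inj]] := card_le_inj x0 Ainf.
have {}f_inj m n : f m = f n -> m = n by exact: f_inj.
(* Hilbert's hotel: [a] takes the place of [f 0], the sequence [f] is shifted by one, and all other
   points stay fixed. *)
pose g x := if pselect (x = a) is left _ then f 0%N else
  if pselect (exists n, f n = x) is left e then f (projT1 (cid e)).+1 else x.
apply: (@card_le_of_inj _ _ _ _ g) => [x|x y].
  rewrite /g; case: pselect => [_ _|xa [] //= Ax]; first exact: fA.
  by case: pselect => // e; exact: fA.
rewrite /g; case: (pselect (x = a)) => [->|xa]; case: (pselect (y = a)) => [->|ya] //.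
- move=> _ _; case: pselect => [e /f_inj //|ny e].
  by case: ny; exists 0%N.
- move=> _ _; case: pselect => [e /f_inj //|nx e].
  by case: nx; exists 0%N.
move=> _ _.
case: (pselect (exists n, f n = x)) => [e|nx];
  case: (pselect (exists n, f n = y)) => [e'|ny] //.
- move/f_inj => -[].
  by case: (cid e) => /= m <-; case: (cid e') => /= n <- ->.
- by move=> E; case: ny; rewrite -E; eexists.
- by move=> E; case: nx; rewrite E; eexists.
Qed.

Lemma card_le_setX {T U V W : Type} (A : set T) (B : set U) (C : set V) (D : set W)
    (v0 : V) (w0 : W) :
  A #<= C -> B #<= D -> A `*` B #<= C `*` D.
Proof.
move=> /(card_le_inj v0)[f [fC f_inj]] /(card_le_inj w0)[g [gD g_inj]].
apply: (@card_le_of_inj _ _ _ _ (fun p => (f p.1, g p.2))) => [[x y] [/= Ax By]|].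
  by split; [exact: fC|exact: gD].
move=> [x y] [x' y'] [/= Ax By] [/= Ax' By'] [fE gE].
by rewrite (f_inj x x') // (g_inj y y').
Qed.

End CardinalArithmetic.

(** * Well-ordered types: infinite cardinals and Goedel's pairing *)

Section Ordinals.
Local Open Scope classical_set_scope.
Local Open Scope card_scope.
Context {d : Order.disp_t} {O : orderType d}.
Hypothesis O_wo : wochoice.well_order (fun x y : O => x <= y).
Implicit Types (a b x y kappa theta mu : O).

Lemma exists_least (P : O -> Prop) x : P x ->
  exists2 m, P m & forall y, P y -> m <= y.
Proof.
move=> Px; have ne : wochoice.nonempty [pred y | `[<P y>]].
  by exists x; apply/asboolP; exact: Px.
have [m [[mP mlb] _]] := O_wo ne.
exists m; first exact/asboolP.
by move=> y Py; apply: mlb; apply/asboolP; exact: Py.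
Qed.

Definition least_of (x0 : O) (A : set O) : O :=
  xget x0 [set m | A m /\ forall y, A y -> m <= y].

Lemma least_ofP x0 A x :
  A x -> A (least_of x0 A) /\ forall y, A y -> least_of x0 A <= y.
Proof.
move=> Ax; have [m Am mlb] := exists_least Ax.
by apply: (@xgetI _ x0 [set m | A m /\ forall y, A y -> m <= y]); split; [exact: Am|].
Qed.

Lemma lt_wf : well_founded (fun x y : O => x < y).
Proof.
move=> x; apply: contrapT => nx.
have [m nm mlb] := @exists_least (fun y => ~ Acc (fun x y : O => x < y) y) x nx.
apply: (nm); apply: Acc_intro => y ym; apply: contrapT => /mlb.
by rewrite leNgt ym.
Qed.

Lemma cardinal_not_le kappa a :
  cardinal kappa -> a < kappa -> ~ (below kappa #<= below a).
Proof.
move=> kC ak ka; apply: (kC a ak); apply/card_eqPle; split=> //.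
by apply: subset_card_le => x /= xa; exact: lt_trans xa ak.
Qed.

Lemma cardinal_repr a :
  exists mu, [/\ mu <= a, cardinal mu & below mu #= below a].
Proof.
have [mu mua mulb] := @exists_least (fun m => below m #= below a) a (card_eqxx _).
exists mu; split=> //; first exact: mulb (card_eqxx _).
move=> b bmu /card_esym bE; have := mulb b (card_eq_trans bE mua).
by rewrite leNgt bmu.
Qed.

(** Otherwise [kappa] would be the successor of [a], and adding a point to an infinite set does not
    raise its size. *)
Lemma infinite_cardinal_limit kappa a : infinite_cardinal kappa ->
  a < kappa -> exists2 b, a < b & b < kappa.
Proof.
move=> [kC kinf] ak; apply: contrapT => nb.
have sub : below kappa `<=` below a `|` [set a].
  move=> x /= xk; have [|xa] := ltP x a; first by left.
  right=> /=; apply/eqP; rewrite eq_le xa andbT leNgt; apply/negP => ax.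
  by apply: nb; exists x.
apply: cardinal_not_le kC ak (card_le_trans (subset_card_le sub) _).
apply: infinite_setU1 => fa; apply: kinf; apply: sub_finite_set sub _.
by rewrite finite_setU; split=> //; exact: finite_set1.
Qed.

(* Goedel's ordering of pairs: its proper initial segments are contained in
   squares of smaller ordinals. *)
Definition goedel_lt (p q : O * O) : Prop :=
  let m (p : O * O) := Order.max p.1 p.2 in
  m p < m q \/ m p = m q /\ (p.1 < q.1 \/ p.1 = q.1 /\ p.2 < q.2).

Lemma goedel_lt_wf : well_founded goedel_lt.
Proof.
move=> p; move: {-1}(Order.max p.1 p.2) (erefl (Order.max p.1 p.2)) => m.
elim/(well_founded_ind lt_wf): m p => m IHm [p1 p2] /=.
elim/(well_founded_ind lt_wf): p1 p2 => p1 IH1 p2.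
elim/(well_founded_ind lt_wf): p2 => p2 IH2 pm.
constructor=> -[q1 q2]; rewrite /goedel_lt /= pm => -[qm|[qm [q1p|[q1E q2p]]]].
- exact: IHm qm (q1, q2) erefl.
- exact: IH1.
- by rewrite q1E in qm *; exact: IH2.
Qed.

Lemma goedel_lt_total p q : p <> q -> goedel_lt p q \/ goedel_lt q p.
Proof.
case: p q => [p1 p2] [q1 q2] pq; rewrite /goedel_lt /=.
case: (ltgtP (Order.max p1 p2) (Order.max q1 q2)) => m; [by left; left|by right; left|].
case: (ltgtP p1 q1) => e1; [by left; right; split=> //; left|by right; right; split=> //; left|].
case: (ltgtP p2 q2) => e2; [by left; right; split=> //; right|by right; right; split=> //; right|].
by case: pq; rewrite e1 e2.
Qed.

Definition goedel_step (p : O * O) (rec : forall q, goedel_lt q p -> O) : O :=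
  least_of p.1 [set z | forall q (h : goedel_lt q p), rec q h <> z].
Definition goedel_code : O * O -> O :=
  Fix goedel_lt_wf (fun _ => O) goedel_step.

Lemma goedel_codeE p : goedel_code p =
  least_of p.1 [set z | forall q, goedel_lt q p -> goedel_code q <> z].
Proof.
rewrite /goedel_code Fix_eq // => q f g fg; rewrite /goedel_step.
suff -> : f = g by [].
by apply: functional_extensionality_dep => r; apply: functional_extensionality_dep.
Qed.


(** Every pair gets a code below [kappa]: otherwise each ordinal below [kappa] codes a predecessor
    of the pair, these predecessors lie in the square of some [b < kappa], and by induction that
    square has size less than [kappa]. *)
Lemma infinite_cardinal_square kappa : infinite_cardinal kappa ->
  below kappa `*` below kappa #<= below kappa.
Proof.
elim/(well_founded_ind lt_wf): kappa => kappa IH kappa_inf.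
have [kC kinf] := kappa_inf.
have codeP p : (below kappa `*` below kappa) p ->
    goedel_code p < kappa /\ forall q, goedel_lt q p -> goedel_code q <> goedel_code p.
  move=> [/= p1k p2k]; pose fresh z := forall q, goedel_lt q p -> goedel_code q <> z.
  suff [z zk fz] : exists2 z, z < kappa & fresh z.
    have := @least_ofP p.1 fresh z fz; rewrite -goedel_codeE => -[fp plb].
    by split=> //; exact: le_lt_trans (plb _ fz) zk.
  apply: contrapT => nofresh.
  have [b mb bk] : exists2 b, Order.max p.1 p.2 < b & b < kappa.
    by apply: infinite_cardinal_limit kappa_inf _; rewrite gt_max p1k.
  have kb : below kappa #<= below b `*` below b.
    apply: (@card_le_of_surj _ _ _ _ goedel_code) => z /= zk.
    apply: contrapT => nz; apply: nofresh; exists z => // -[q1 q2] qp qz; apply: nz.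
    exists (q1, q2) => //.
    have qb : Order.max q1 q2 < b by case: qp => [/= /lt_trans|/= [->]]; last by []; exact.
    by move: qb; rewrite gt_max => /andP[].
  have [mu [mub muC /card_eqPle[mub' bmu]]] := cardinal_repr b.
  have [fmu|infmu] := pselect (finite_set (below mu)).
    apply: kinf; apply: card_le_finite kb _.
    by apply: finite_setX; exact: card_le_finite bmu fmu.
  apply: cardinal_not_le kC (le_lt_trans mub bk) _.
  apply: card_le_trans kb _; apply: card_le_trans (IH mu (le_lt_trans mub bk) (conj muC infmu)).
  exact: card_le_setX.
apply: (@card_le_of_inj _ _ _ _ goedel_code) => [p /codeP[]//|p q pk qk pq].
apply: contrapT => /goedel_lt_total[/(proj2 (codeP _ qk))|/(proj2 (codeP _ pk))] //.
by apply.
Qed.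

(** Decoding is what the colourings need: one index [z] carries two parameters. *)
Lemma pairing kappa : infinite_cardinal kappa ->
  exists p : O -> O * O, forall x y, x < kappa -> y < kappa ->
    exists2 z, z < kappa & p z = (x, y).
Proof.
move=> kinf; have [p pP] := card_le_surj (kappa, kappa) (infinite_cardinal_square kinf).
by exists p => x y xk yk; exact: (pP (x, y)).
Qed.

Lemma infinite_cardinal_le theta kappa :
  infinite_cardinal theta -> cardinal kappa -> theta <= kappa ->
  infinite_cardinal kappa.
Proof.
move=> [_ tinf] kC tk; split=> // kfin; apply: tinf; apply: sub_finite_set kfin.
by move=> x /= xt; exact: lt_le_trans xt tk.
Qed.

(** * Successor cardinals: enumerations and regularity *)

Section SuccessorCardinal.
Variables theta lambda : O.
Hypotheses (theta_inf : infinite_cardinal theta)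
  (lambda_succ : is_succ_cardinal theta lambda).

Lemma succ_infinite : infinite_cardinal lambda.
Proof.
by case: lambda_succ => lC tl _; exact: infinite_cardinal_le theta_inf lC (ltW tl).
Qed.

Lemma below_succ_card a : a < lambda -> below a #<= below theta.
Proof.
move=> al; have [mu [mua muC /card_eqPle[_ amu]]] := cardinal_repr a.
apply: card_le_trans amu _; apply: subset_card_le => x /= xmu.
apply: lt_le_trans xmu _; rewrite leNgt; apply/negP => tmu.
case: lambda_succ => _ _ /(_ mu muC tmu) lmu.
by have := lt_le_trans al (le_trans lmu mua); rewrite ltxx.
Qed.

Lemma succ_enumeration : exists e : O -> O -> O,
  forall a, a < lambda -> forall x, x < a -> exists2 i, i < theta & e a i = x.
Proof.
suff /choice[e eP] : forall a, exists ea : O -> O, a < lambda ->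
    forall x, x < a -> exists2 i, i < theta & ea i = x by exists e.
move=> a; have [al|al] := pselect (a < lambda); last by exists id.
by have [ea eaP] := card_le_surj a (below_succ_card al); exists ea.
Qed.

(** If the values [s i] were unbounded, every [x < lambda] would be listed as [e (s i) j] for some
    [i, j < theta], so [lambda] would have size at most that of [theta]. *)
Lemma succ_sup (s : O -> O) : (forall i, i < theta -> s i < lambda) ->
  exists2 b, b < lambda & forall i, i < theta -> s i < b.
Proof.
move=> sl; apply: contrapT => nb; have [lC tl _] := lambda_succ.
have [e eP] := succ_enumeration; have [p pP] := pairing theta_inf.
apply: (cardinal_not_le lC tl).
apply: (@card_le_of_surj _ _ _ _ (fun z => e (s (p z).1) (p z).2)) => x /= xl.
have [y xy yl] := infinite_cardinal_limit succ_infinite xl.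
have [i [it yi]] : exists i, i < theta /\ y <= s i.
  apply: contrapT => ni; apply: nb; exists y => // i it.
  by rewrite ltNge; apply/negP => yi; apply: ni; exists i.
have [j jt ej] := eP (s i) (sl i it) x (lt_le_trans xy yi).
by have [z zt pz] := pP i j it jt; exists z => //; rewrite pz.
Qed.

End SuccessorCardinal.

End Ordinals.

(** * Functions from theta to theta, bounding and dominating families, interval partitions *)

Section Functions.
Local Open Scope classical_set_scope.
Local Open Scope card_scope.
Context {d : Order.disp_t} {O : orderType d}.
Hypothesis O_wo : wochoice.well_order (fun x y : O => x <= y).
Variable theta : O.
Hypothesis theta_reg : infinite_regular theta.
Implicit Types (a b x y i kappa : O).

Local Notation X := (below theta).

Definition maps_below (g : O -> O) := forall i, i < theta -> g i < theta.

(** Families for [lt_star] live on the subtype [below theta]; extending them by the identity lets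
    arguments and values be plain elements of [O]. *)
Definition lift (f : X -> X) (x : O) : O :=
  if pselect (below theta x) is left h then \val (f (SigSub (mem_set h))) else x.

Lemma lift_val f (i : X) : lift f (\val i) = \val (f i).
Proof.
rewrite /lift; case: pselect => [h|[]]; last exact: (@set_valP _ (below theta)).
by congr (\val (f _)); apply: val_inj.
Qed.

Lemma below_val i : i < theta -> exists j : X, \val j = i.
Proof. by move=> it; exists (SigSub (mem_set (it : below theta i))). Qed.

Lemma lift_below f : maps_below (lift f).
Proof.
by move=> i /below_val[j <-]; rewrite lift_val; exact: (@set_valP _ (below theta)).
Qed.

Lemma lift_surj g : maps_below g ->
  exists f : X -> X, forall i, i < theta -> lift f i = g i.
Proof.
move=> gt; have gX (j : X) : below theta (g (\val j)).
  by apply: gt; exact: (@set_valP _ (below theta)).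
exists (fun j => SigSub (mem_set (gX j))) => i /below_val[j <-].
by rewrite lift_val.
Qed.

Lemma theta_inf : infinite_cardinal theta.
Proof. by case: theta_reg. Qed.

Lemma theta_inhabited : exists x, x < theta.
Proof. by case: theta_inf => _ /infinite_setN0[x]; exists x. Qed.

Lemma lt_starP (f g : X -> X) : lt_star f g <->
  exists2 a, a < theta & forall i, a < i -> i < theta -> lift f i < lift g i.
Proof.
split=> [[_ [a at_ ub]]|[a at_ fg]].
  exists a => // i ai /below_val[j ji]; rewrite -ji !lift_val ltNge; apply/negP => gf.
  have : i <= a by apply: ub; exists j.
  by rewrite leNgt ai.
split; first by move=> _ [i _ <-]; exact: (@set_valP _ (below theta)).
exists a => // _ [i /= gf <-]; rewrite leNgt; apply/negP => ai.
have := fg _ ai (@set_valP _ (below theta) i).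
by rewrite !lift_val ltNge gf.
Qed.

Lemma lt_star_le_trans (f g h : X -> X) : lt_star f g ->
  (forall i, i < theta -> lift g i <= lift h i) -> lt_star f h.
Proof.
move=> /lt_starP[a at_ fg] gh; apply/lt_starP; exists a => // i ai it.
exact: lt_le_trans (fg i ai it) (gh i it).
Qed.

Lemma le_lt_star_trans (f g h : X -> X) :
  (forall i, i < theta -> lift f i <= lift g i) -> lt_star g h -> lt_star f h.
Proof.
move=> fg /lt_starP[a at_ gh]; apply/lt_starP; exists a => // i ai it.
exact: le_lt_trans (fg i it) (gh i ai it).
Qed.

(** An unbounded [A] would be cofinal, hence of size at least theta. *)
Lemma regular_bounded (A : set O) a : A `<=` below theta -> a < theta ->
  A #<= below a -> exists2 b, b < theta & forall x, A x -> x < b.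
Proof.
move=> At at_ Aa; apply: contrapT => nb; case: theta_reg => -[tC _] [_ _ /(_ A) H].
apply: (cardinal_not_le tC at_); apply: card_le_trans Aa; apply: H; split=> // b bt.
apply: contrapT => nx; apply: nb; exists b => // x Ax.
by rewrite ltNge; apply/negP => bx; apply: nx; exists x.
Qed.

Lemma small_family_bounded (F : set (X -> X)) a : a < theta -> F #<= below a ->
  exists g : X -> X, forall f, F f -> forall i, i < theta -> lift f i < lift g i.
Proof.
move=> at_ Fa.
have /choice[g gP] : forall i : O, exists b, i < theta -> b < theta /\ forall f, F f -> lift f i < b.
  move=> i; have [it|it] := pselect (i < theta); last by exists i.
  have [|||b bt ub] := @regular_bounded [set lift f i | f in F] a => //.
  - by move=> _ [f _ <-]; exact: lift_below.
  - exact: card_le_trans (card_image_le _ _) Fa.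
  by exists b => _; split=> // f Ff; apply: ub; exists f.
have [h hg] := @lift_surj g (fun i it => proj1 (gP i it)).
by exists h => f Ff i it; rewrite hg //; exact: (proj2 (gP i it)).
Qed.

Lemma le_bounding kappa : is_bounding_number theta kappa -> theta <= kappa.
Proof.
move=> [_ [F Funb /card_eqPle[Fk _]] _]; rewrite leNgt; apply/negP => kt.
have [g gP] := small_family_bounded kt Fk; apply: Funb; exists g => f Ff.
have [x xt] := theta_inhabited.
by apply/lt_starP; exists x => // i _ it; exact: gP.
Qed.

Lemma le_dominating kappa : is_dominating_number theta kappa -> theta <= kappa.
Proof.
move=> [_ [F Fdom /card_eqPle[Fk _]] _]; rewrite leNgt; apply/negP => kt.
have [g gP] := small_family_bounded kt Fk; have [f Ff /lt_starP[a at_ gf]] := Fdom g.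
have [i ai it] := infinite_cardinal_limit theta_inf at_.
by have := lt_trans (gf i ai it) (gP f Ff i it); rewrite ltxx.
Qed.

Lemma bounding_family_bounded kappa mu (h : O -> X -> X) :
  is_bounding_number theta kappa -> mu < kappa ->
  exists g : X -> X, forall x, x < mu -> lt_star (h x) g.
Proof.
move=> [kC _ kmin] muk.
have : ~ unbounded_family (h @` below mu).
  move=> /kmin km; apply: (cardinal_not_le kC muk).
  exact: card_le_trans km (card_image_le _ _).
by move=> /contrapT[g gP]; exists g => x xmu; apply: gP; exists x.
Qed.

Lemma bounding_eventual_bound kappa mu (t : O -> O -> O) :
  is_bounding_number theta kappa -> mu < kappa ->
  (forall x, x < mu -> maps_below (t x)) ->
  exists2 g, maps_below g & forall x, x < mu ->
    exists2 a, a < theta & forall i, a < i -> i < theta -> t x i < g i.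
Proof.
move=> kb muk tX.
have /choice[h hP] : forall x, exists f : X -> X,
    x < mu -> forall i, i < theta -> lift f i = t x i.
  move=> x; have [xmu|xmu] := pselect (x < mu); last by exists id.
  by have [f fP] := lift_surj (tX x xmu); exists f.
have [g gP] := bounding_family_bounded h kb muk.
exists (lift g); first exact: lift_below.
move=> x xmu; have /lt_starP[a at_ ag] := gP x xmu; exists a => // i ai it.
by rewrite -(hP x xmu i it); exact: ag.
Qed.

(** One coordinate where [G b] exceeds [g] is enough, because the ideal argument bounds all
    coordinates at once. *)
Definition eventually_unbounded kappa (G : O -> O -> O) : Prop :=
  (forall b, maps_below (G b)) /\
  forall g, maps_below g -> exists2 a, a < kappa &
    forall b, a < b -> b < kappa -> exists2 i, i < theta & g i < G b i.

(** Let [h] enumerate an unbounded family and [G b] bound all [h x] with [x < b]. If [g] were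
    everywhere above [G b] for cofinally many [b], it would bound the whole family. *)
Lemma bounding_eventually_unbounded kappa : is_bounding_number theta kappa ->
  exists G, eventually_unbounded kappa G.
Proof.
move=> kb; have [_ [F Funb /card_eqPle[Fk _]] _] := kb.
have [h hP] := card_le_surj (id : X -> X) Fk.
have /choice[G GP] : forall b, exists f : X -> X,
    b < kappa -> forall x, x < b -> lt_star (h x) f.
  move=> b; have [bk|bk] := pselect (b < kappa); last by exists id.
  by have [f fP] := bounding_family_bounded h kb bk; exists f.
exists (fun b => lift (G b)); split; first by move=> b; exact: lift_below.
move=> g0 /lift_surj[g gE]; apply: contrapT => na; apply: Funb; exists g => f Ff.
have [a ak haf] := hP f Ff; apply: contrapT => nfg; apply: na; exists a => // b ab bk.
apply: contrapT => ni; apply: nfg; rewrite -haf.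
apply: lt_star_le_trans (GP b bk a ab) _ => i it.
by rewrite leNgt; apply/negP => gG; apply: ni; exists i => //; rewrite -gE.
Qed.

(** Let [h] enumerate a dominating family and [G b] be a function that no [h x] with [x < b]
    dominates. Once [h x] dominates [g], no [G b] with [b > x] can stay below [g]. *)
Lemma dominating_eventually_unbounded kappa : is_dominating_number theta kappa ->
  exists G f : O -> O -> O, [/\ eventually_unbounded kappa G,
    forall x, maps_below (f x) &
    forall g, maps_below g -> exists2 x, x < kappa &
      exists2 a, a < theta & forall i, a < i -> i < theta -> g i < f x i].
Proof.
move=> [kC [F Fdom /card_eqPle[Fk _]] kmin].
have [h hP] := card_le_surj (id : X -> X) Fk.
have /choice[G GP] : forall b, exists g : X -> X,
    b < kappa -> forall x, x < b -> ~ lt_star g (h x).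
  move=> b; have [bk|bk] := pselect (b < kappa); last by exists id.
  have : ~ dominating_family (h @` below b).
    move=> /kmin kb; apply: (cardinal_not_le kC bk).
    exact: card_le_trans kb (card_image_le _ _).
  move=> nd; apply: contrapT => ng; apply: nd => g; apply: contrapT => ngf.
  apply: ng; exists g => _ x xb gh; apply: ngf; exists (h x) => //; by exists x.
have dom g : maps_below g -> exists2 x, x < kappa &
    exists2 g', (forall i, i < theta -> lift g' i = g i) & lt_star g' (h x).
  move=> /lift_surj[g' gE]; have [f Ff gf] := Fdom g'; have [x xk hx] := hP f Ff.
  by exists x => //; exists g' => //; rewrite hx.
exists (fun b => lift (G b)), (fun x => lift (h x)); split.
- split; first by move=> b; exact: lift_below.
  move=> g /dom[x xk [g' gE gh]]; exists x => // b xb bk; apply: contrapT => ni.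
  apply: (GP b bk x xb); apply: le_lt_star_trans gh => i it.
  by rewrite leNgt gE //; apply/negP => gG; apply: ni; exists i.
- by move=> x; exact: lift_below.
- move=> g /dom[x xk [g' gE /lt_starP[a at_ gh]]]; exists x => //; exists a => // i ai it.
  by rewrite -gE //; exact: gh.
Qed.

(* Greedy choice: the intervals [x, g x) of distinct block starts [x] are
   disjoint, and regularity makes the block starts unbounded in theta. *)
Definition block_start (g : O -> O) : O -> Prop :=
  Fix (lt_wf O_wo) (fun _ => Prop) (fun y rec => forall x (h : x < y), rec x h -> g x <= y).

Lemma block_startE g y :
  block_start g y = (forall x, x < y -> block_start g x -> g x <= y).
Proof.
rewrite {1}/block_start Fix_eq // => z f h fh.
suff -> : f = h by [].
by apply: functional_extensionality_dep => x; apply: functional_extensionality_dep.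
Qed.

Lemma block_start_disjoint g x y e : block_start g x -> block_start g y ->
  x <= e < g x -> y <= e < g y -> x = y.
Proof.
move=> gx gy /andP[xe egx] /andP[ye egy]; apply/eqP; rewrite eq_le !leNgt.
apply/andP; split; apply/negP => xy.
- move: gx; rewrite block_startE => /(_ _ xy gy) /le_trans/(_ xe).
  by rewrite leNgt egy.
- move: gy; rewrite block_startE => /(_ _ xy gx) /le_trans/(_ ye).
  by rewrite leNgt egx.
Qed.

(** If all block starts were below [a], then [g] on [below a] would be bounded by some [b], making
    [Order.max a b] a block start. So they are cofinal, and regularity gives their size. *)
Lemma card_block_starts g : maps_below g ->
  below theta #<= [set x | x < theta /\ block_start g x].
Proof.
move=> gt; case: (theta_reg) => _ [_ _]; apply; split=> [x []//|a at_].
apply: contrapT => na.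
have Da x : x < theta -> block_start g x -> x < a.
  by move=> xt gx; rewrite ltNge; apply/negP => ax; apply: na; exists x.
have [|||b bt gb] := @regular_bounded (g @` below a) a => //.
- by move=> _ [x /= xa <-]; apply: gt; exact: lt_trans xa at_.
- exact: card_image_le.
have mt : Order.max a b < theta by rewrite gt_max at_.
suff /(Da _ mt) : block_start g (Order.max a b) by rewrite gt_max ltxx.
rewrite block_startE => x xm gx.
rewrite le_max; apply/orP; right; apply: ltW; apply: gb; exists x => //.
by apply: Da => //; exact: lt_trans xm mt.
Qed.

(** Blocks are labelled so that each colour [y] labels cofinally many of them, and a point takes the
    label of its block; a set meeting all late blocks then gets every colour. *)
Lemma block_colouring g : maps_below g -> exists2 col, maps_below col &
  forall (T : set O) a, a < theta ->
    (forall i, a < i -> i < theta -> exists2 e, T e & i <= e < g i) ->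
    forall y, y < theta -> exists2 e, T e & col e = y.
Proof.
move=> gt; have [s sP] := card_le_surj theta (card_block_starts gt).
have [p pP] := pairing O_wo theta_inf.
pose h x := (p (s x)).1.
have hP y a : y < theta -> a < theta ->
    exists x, [/\ a < x, x < theta, block_start g x & h x = y].
  move=> yt at_; apply: contrapT => nx; have [tC _] := theta_inf.
  have [b ab bt] := infinite_cardinal_limit theta_inf at_.
  (* Otherwise the blocks labelled [y] all start below [b], while the second components of their
     codes exhaust theta. *)
  apply: (cardinal_not_le tC bt).
  apply: (@card_le_of_surj _ _ _ _ (fun x => (p (s x)).2)) => z zt.
  have [w wt pw] := pP y z yt zt; have [x [xt gx] sx] := sP w wt.
  exists x; last by rewrite sx pw.
  apply: (le_lt_trans _ ab); rewrite leNgt; apply/negP => ax.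
  by apply: nx; exists x; split=> //; rewrite /h sx pw.
pose start e := least_of e [set x | block_start g x /\ x <= e < g x].
(* [p] and [s] are uncontrolled outside their intended domains, so the test keeps the colour below
   theta. *)
exists (fun e => if h (start e) < theta then h (start e) else e).
  by move=> e et; case: ifPn.
move=> T a at_ Tg y yt; have [x [ax xt gx hx]] := hP y a yt at_.
have [e Te xe] := Tg x ax xt; exists e => //.
have [[gs se] _] := @least_ofP _ _ O_wo e [set x | block_start g x /\ x <= e < g x] x (conj gx xe).
by rewrite /start (block_start_disjoint gs gx se xe) hx yt.
Qed.

End Functions.

(** * Positive sets of theta^+-complete ideals *)

Section Ideals.
Local Open Scope classical_set_scope.
Local Open Scope card_scope.
Context {d : Order.disp_t} {O : orderType d}.
Hypothesis O_wo : wochoice.well_order (fun x y : O => x <= y).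
Variables theta lambda kappa : O.
Hypotheses (theta_reg : infinite_regular theta)
  (lambda_succ : is_succ_cardinal theta lambda).
Variable J : set (set O).
Hypothesis J_ideal : complete_ideals kappa lambda J.
Implicit Types (a b x y i : O) (A B : set O).

Lemma positive_sub A B :
  positive kappa J A -> A `<=` B -> B `<=` below kappa -> positive kappa J B.
Proof.
case: J_ideal => -[_ _ Jsub _] _ _ [_ nJA] AB Bk; split=> // JB.
by apply: nJA; exact: Jsub AB JB.
Qed.

(** By theta^+-completeness the union of theta many members of [J] is in [J], so removing it from
    [B] leaves a positive set. *)
Lemma positive_avoid (A : O -> set O) B : positive kappa J B ->
  (forall i, i < theta -> J (A i)) ->
  positive kappa J [set b | B b /\ forall i, i < theta -> ~ A i b].
Proof.
case: J_ideal => -[_ Jk Jsub JU] Jcompl _ [Bk nJB] JA; split; first by move=> b [/Bk].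
move=> JB'; apply: nJB.
have JUA : J (\bigcup_(C in A @` below theta) C).
  case: lambda_succ => lC tl _; apply: Jcompl.
  - by move=> _ [i it <-]; exact: JA.
  - apply: card_le_trans (card_image_le _ _) _; apply: subset_card_le => x /= xt.
    exact: lt_trans xt tl.
  - move=> /card_eqPle[_ lA]; apply: (cardinal_not_le lC tl).
    exact: card_le_trans lA (card_image_le _ _).
apply: Jsub (JU _ _ JUA JB') => b Bb /=.
have [[i [it Aib]]|ni] := pselect (exists i, i < theta /\ A i b).
  by left; exists (A i) => //; exists i.
by right; split=> // i it Aib; apply: ni; exists i.
Qed.

Lemma positive_above B a : positive kappa J B -> a < kappa ->
  exists2 b, B b & a < b.
Proof.
case: J_ideal => _ _ Jbd [Bk nJB] ak; apply: contrapT => nb; apply: nJB; apply: Jbd.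
split=> //; exists a => // x Bx; rewrite leNgt; apply/negP => ax.
by apply: nb; exists x.
Qed.

Lemma positive_tail B a : positive kappa J B -> a < kappa ->
  positive kappa J [set b | B b /\ a < b].
Proof.
case: J_ideal => -[_ _ Jsub JU] _ Jbd [Bk nJB] ak; split; first by move=> b [/Bk].
move=> Ja; apply: nJB; apply: (Jsub _ ([set b | B b /\ a < b] `|` [set b | B b /\ b <= a])).
  by move=> b Bb; have [ab|ab] := leP b a; [right|left].
apply: JU Ja _; apply: Jbd; split; first by move=> b [/Bk].
by exists a => // b [].
Qed.

(** If no piece were positive, avoiding all of them would leave a positive, hence nonempty, set of
    points lying in no piece. *)
Lemma positive_split (A : O -> set O) B : theta <= kappa -> positive kappa J B ->
  (forall b, B b -> exists2 i, i < theta & A i b) ->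
  exists2 i, i < theta & positive kappa J [set b | B b /\ A i b].
Proof.
move=> tk Bpos BA; apply: contrapT => ni.
have : positive kappa J
    [set b | B b /\ forall i, i < theta -> ~ [set b | B b /\ A i b] b].
  apply: positive_avoid => // i it; apply: contrapT => nJ; apply: ni; exists i => //.
  by split=> //; move=> b [Bb _]; case: Bpos => /(_ b Bb).
have [x xt] := theta_inhabited theta_reg.
move=> /positive_above/(_ (lt_le_trans xt tk))[b [Bb nA] _].
by have [i it Ab] := BA b Bb; apply: (nA i it).
Qed.

(** The points of [A] up to [x] form a bounded set, so the side condition [x < b] in the fibre costs
    nothing. *)
Lemma positive_colour_fibre (c : O -> O -> O) (A B : set O) x y :
  positive kappa J A -> positive kappa J B -> A `<=` B -> x < kappa ->
  (forall b, A b -> x < b -> c x b = y) ->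
  positive kappa J (colour_fibre c B x y).
Proof.
move=> Apos [Bk _] AB xk cA; apply: (positive_sub (positive_tail Apos xk)).
  by move=> b [Ab xb]; split=> //; [exact: AB|exact: cA].
by move=> b [/Bk].
Qed.

(* If every coordinate were almost bounded on [B], the bounds would form a
   function dominating [G b] for all [b] in a positive subset of [B]. *)
Lemma positive_unbounded_coordinate G B : theta <= kappa ->
  eventually_unbounded theta kappa G -> positive kappa J B ->
  exists2 i, i < theta & forall a, a < theta ->
    exists e, [/\ a < e, e < theta & positive kappa J [set b | B b /\ G b i = e]].
Proof.
move=> tk [Gt Gunb] Bpos; apply: contrapT => ni.
have /choice[g gP] : forall i, exists a, i < theta -> a < theta /\
    forall e, a < e -> e < theta -> ~ positive kappa J [set b | B b /\ G b i = e].
  move=> i; have [it|it] := pselect (i < theta); last by exists i.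
  apply: contrapT => na; apply: ni; exists i => // a at_; apply: contrapT => ne.
  apply: na; exists a => _; split=> // e ae et epos; apply: ne; by exists e.
have [c ck cG] := Gunb g (fun i it => proj1 (gP i it)).
pose A i := [set b | B b /\ g i < G b i].
have JA i : i < theta -> J (A i).
  (* A positive [A i] would split by the value of [G b i], giving a value above [g i] taken
     positively often, against the choice of [g i]. *)
  move=> it; apply: contrapT => nJ.
  have Apos : positive kappa J (A i).
    by split=> // b [Bb _]; case: Bpos => /(_ b Bb).
  have [e et epos] := @positive_split (fun e => [set b | G b i = e]) _ tk Apos
    (fun b _ => ex_intro2 _ _ (G b i) (Gt b i it) erefl).
  have [b [[Bb gG] /= Ge] _] := positive_above epos ck.
  apply: (proj2 (gP i it) e) => //; first by rewrite -Ge.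
  apply: positive_sub epos _ _; first by move=> b' [[]].
  by move=> b' [Bb' _]; case: Bpos => /(_ b' Bb').
have [b [Bb nA] cb] := positive_above (positive_avoid Bpos JA) ck.
have bk : b < kappa by case: Bpos => /(_ b Bb).
by have [i it gG] := cG b cb bk; apply: (nA i it).
Qed.

End Ideals.

(** * The four colourings *)

Section Colourings.
Local Open Scope classical_set_scope.
Local Open Scope card_scope.
Context {d : Order.disp_t} {O : orderType d}.
Hypothesis O_wo : wochoice.well_order (fun x y : O => x <= y).
Variables theta lambda : O.
Hypotheses (theta_reg : infinite_regular theta)
  (lambda_succ : is_succ_cardinal theta lambda).
Implicit Types (a b x y i kappa : O).

Let theta_infinite : infinite_cardinal theta := theta_inf theta_reg.

(** Forces a colour below [v] at indices that code nothing meaningful. *)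
Definition clip (v x0 x : O) : O := if x < v then x else x0.

Lemma clip_lt v x0 x : x0 < v -> clip v x0 x < v.
Proof. by rewrite /clip; case: ifPn. Qed.

Lemma clipE v x0 x : x < v -> clip v x0 x = x.
Proof. by rewrite /clip => ->. Qed.

Lemma bounding_onto kappa : is_bounding_number theta kappa ->
  onto theta (Jbd theta) theta ->
  onto_plus kappa theta (complete_ideals kappa lambda) theta.
Proof.
move=> kb [c _ conto]; have tk := le_bounding theta_reg kb.
have [G Gunb] := bounding_eventually_unbounded kb.
have [p pP] := pairing O_wo theta_infinite; have [x0 x0t] := theta_inhabited theta_reg.
(* The index [z] codes a pair [(eta, i)]: a row of [c] and a coordinate of [G b]. *)
pose col z b := clip theta x0 (c (p z).1 (G b (p z).2)).
exists col => [z b _ _|J J_ideal B Bpos]; first exact: clip_lt.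
have [i it iP] := positive_unbounded_coordinate theta_reg lambda_succ J_ideal tk Gunb Bpos.
pose T := [set e | e < theta /\ positive kappa J [set b | B b /\ G b i = e]].
have [|eta etat etaP] := conto T.
  split=> [e []//|[_ [a at_ Ta]]]; have [e [ae et epos]] := iP a at_.
  by have := Ta e (conj et epos); rewrite leNgt ae.
have [z zt pz] := pP eta i etat it; exists z => // y yt.
have : below theta y by []; rewrite -etaP => -[e [[et epos] ee] cy].
apply: (positive_colour_fibre J_ideal epos Bpos) => [b []//||b [_ Ge] _].
  exact: lt_le_trans zt tk.
by rewrite /col pz /= Ge cy clipE.
Qed.

Lemma bounding_succ_onto : is_bounding_number theta lambda ->
  onto theta (Jbd theta) theta ->
  onto_plus lambda theta (complete_ideals lambda lambda) lambda.
Proof.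
move=> kb /(bounding_onto kb)[c _ cP]; have [_ tl _] := lambda_succ.
have [p pP] := pairing O_wo theta_infinite; have [x0 x0t] := theta_inhabited theta_reg.
have [e eP] := succ_enumeration O_wo lambda_succ.
(* With [z] coding [(eta, i)], the label of [b] is [e b i], and the theta-colour [c eta b] picks an
   element from the enumeration of that label. *)
pose col z b := clip lambda x0 (e (e b (p z).2) (c (p z).1 b)).
exists col => [z b _ _|J J_ideal B Bpos]; first by apply: clip_lt; exact: lt_trans tl.
apply: contrapT => nz.
have /choice[s sP] : forall z, exists y, z < theta ->
    y < lambda /\ ~ positive lambda J (colour_fibre col B z y).
  move=> z; have [zt|zt] := pselect (z < theta); last by exists z.
  apply: contrapT => ny; apply: nz; exists z => // y yl; apply: contrapT => npos.
  by apply: ny; exists y.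
have [b bl sb] := succ_sup O_wo theta_infinite lambda_succ (fun z zt => proj1 (sP z zt)).
(* The bound [b] of all missed colours occurs in the enumeration of every larger [x], so one [i]
   makes [b] the label on a positive set. *)
have [x xb|i it ipos] := @positive_split _ _ theta lambda lambda theta_reg lambda_succ J J_ideal
  (fun i => [set x | e x i = b]) [set x | B x /\ b < x] (ltW tl) (positive_tail J_ideal Bpos bl).
  case: xb => Bx bx; have xl : x < lambda by case: Bpos => /(_ x Bx).
  exact: eP.
have [eta etat etaP] := cP J J_ideal _ ipos.
have [z zt pz] := pP eta i etat it.
have [y yt ey] := eP b bl (s z) (sb z zt).
apply: (proj2 (sP z zt)).
apply: (positive_colour_fibre J_ideal (etaP y yt) Bpos).
- by move=> x [[[]]].
- exact: lt_trans zt tl.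
- move=> x [[_ /= ex] _ cy] _; rewrite /col pz /= ex cy ey clipE //.
  by case: (sP z zt).
Qed.

(** One interval partition per member of a dominating family suffices; strict domination turns the
    closed intervals up to [g i] into the half-open ones used for blocks. *)
Lemma dominating_blocks kappa : is_dominating_number theta kappa ->
  exists G blk : O -> O -> O, [/\ eventually_unbounded theta kappa G,
    forall x, maps_below theta (blk x) &
    forall g, maps_below theta g -> exists2 x, x < kappa &
      forall (T : set O) a, a < theta ->
        (forall i, a < i -> i < theta -> exists2 e, T e & i <= e <= g i) ->
        forall y, y < theta -> exists2 e, T e & blk x e = y].
Proof.
move=> kd; have [G [f [Gunb fmaps fdom]]] := dominating_eventually_unbounded kd.
have /choice[blk blkP] : forall x, exists col, maps_below theta col /\
  forall (T : set O) a, a < theta ->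
    (forall i, a < i -> i < theta -> exists2 e, T e & i <= e < f x i) ->
    forall y, y < theta -> exists2 e, T e & col e = y.
  by move=> x; have [col] := block_colouring O_wo theta_reg (fmaps x); exists col.
exists G, blk; split=> // [x|g /fdom[x xk [a at_ gf]]]; first by case: (blkP x).
exists x => // T b bt Tg; have mt : Order.max a b < theta by rewrite gt_max at_.
apply: (proj2 (blkP x) T _ mt) => i; rewrite gt_max => /andP[ai bi] it.
have [e Te /andP[ie eg]] := Tg i bi it; exists e => //.
by rewrite ie (le_lt_trans eg) // gf.
Qed.

Lemma dominating_onto kappa : is_dominating_number theta kappa ->
  onto_plus kappa kappa (complete_ideals kappa lambda) theta.
Proof.
move=> kd; have tk := le_dominating theta_reg kd.
have kappa_infinite : infinite_cardinal kappa.
  by case: kd => kC _ _; exact: infinite_cardinal_le theta_infinite kC tk.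
have [G [blk [Gunb _ blkP]]] := dominating_blocks kd.
have [p pP] := pairing O_wo kappa_infinite; have [x0 x0t] := theta_inhabited theta_reg.
pose col z b := clip theta x0 (blk (p z).1 (G b (p z).2)).
exists col => [z b _ _|J J_ideal B Bpos]; first exact: clip_lt.
have [i it iP] := positive_unbounded_coordinate theta_reg lambda_succ J_ideal tk Gunb Bpos.
(* [t a] is a positively taken value above [a], so a partition suited to [t] has positive values in
   all late blocks. *)
have /choice[t tP] : forall a, exists e, a < theta ->
    [/\ a < e, e < theta & positive kappa J [set b | B b /\ G b i = e]].
  move=> a; have [/iP[e]|at_] := pselect (a < theta); last by exists a.
  by exists e.
have [x xk xT] := blkP t (fun a at_ => let: And3 _ et _ := tP a at_ in et).
have [z zk pz] := pP x i xk (lt_le_trans it tk); exists z => // y yt.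
have [|e [et epos] ey] := xT [set e | e < theta /\ positive kappa J [set b | B b /\ G b i = e]] x0 x0t _ y yt.
  by move=> j _ jt; have [jl tt tpos] := tP j jt; exists (t j) => //; rewrite lexx ltW.
apply: (positive_colour_fibre J_ideal epos Bpos) => // [b []//|b [_ Ge] _].
by rewrite /col pz /= Ge ey clipE.
Qed.

(** If [A] lay below [a], the order isomorphism would map part of [below a] onto [below lambda]. *)
Lemma otp_cofinal (A : set O) a : has_otp A lambda -> a < lambda ->
  exists2 x, A x & a <= x.
Proof.
move=> [f [_ _ fsurj] _] al; have [lC _ _] := lambda_succ; apply: contrapT => nx.
apply: (cardinal_not_le lC al); apply: (@card_le_of_surj _ _ _ _ f) => y /fsurj[x Ax <-].
by exists x => //=; rewrite /below /= ltNge; apply/negP => ax; apply: nx; exists x.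
Qed.

Lemma dominating_succ_onto kappa b : is_dominating_number theta kappa ->
  is_bounding_number theta b -> lambda < b ->
  unbounded_plus kappa kappa (complete_ideals kappa lambda) lambda ->
  onto_plus kappa kappa (complete_ideals kappa lambda) lambda.
Proof.
move=> kd bb lb [c [_ _ cP]]; have tk := le_dominating theta_reg kd.
have kappa_infinite : infinite_cardinal kappa.
  by case: kd => kC _ _; exact: infinite_cardinal_le theta_infinite kC tk.
have [_ tl _] := lambda_succ.
have [G [blk [Gunb _ blkP]]] := dominating_blocks kd.
have [p pP] := pairing O_wo kappa_infinite; have [x0 x0t] := theta_inhabited theta_reg.
have [e eP] := succ_enumeration O_wo lambda_succ.
(* Here [z] codes [(eta, (alpha, i))]: [c eta b] is the label, and partition [alpha] at coordinate
   [i] picks an element of its enumeration. *)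
pose col z b :=
  clip lambda x0 (e (c (p z).1 b) (blk (p (p z).2).1 (G b (p (p z).2).2))).
exists col => [z b' _ _|J J_ideal B Bpos]; first by apply: clip_lt; exact: lt_trans tl.
have [eta etak etaP] := cP J J_ideal B Bpos.
pose fibre := colour_fibre c B eta.
pose split_by x i a :=
  [set b | fibre x b /\ G b i = a].
have /choice[it itP] : forall x, exists it : O * (O -> O), maps_below theta it.2 /\
    (positive kappa J (fibre x) -> it.1 < theta /\ forall a, a < theta ->
      a <= it.2 a /\ positive kappa J (split_by x it.1 (it.2 a))).
  move=> x; have [xpos|xpos] := pselect (positive kappa J (fibre x)); last first.
    by exists (x, id); split.
  have [i it iP] := positive_unbounded_coordinate theta_reg lambda_succ J_ideal tk Gunb xpos.
  have /choice[t tP] : forall a, exists e, a < theta ->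
      [/\ a < e, e < theta & positive kappa J (split_by x i e)].
    move=> a; have [/iP[a']|at_] := pselect (a < theta); last by exists a.
    by exists a'.
  exists (i, t); split=> [a /tP[]//|_]; split=> // a /tP[aa' _ apos].
  by split=> //; exact: ltW.
(* As [lambda] is below the bounding number, one [g] eventually bounds the functions of all labels,
   so a single partition [alpha] works for every label. *)
have [g gmaps gP] := bounding_eventual_bound bb lb (fun x _ => proj1 (itP x)).
have [alpha alphak alphaP] := blkP g gmaps.
apply: contrapT => nz.
(* [q i] pairs a missed colour with the index coding [(eta, (alpha, i))]. Only [i] varies, so the
   missed colours are bounded below [lambda]. *)
have /choice[q qP] : forall i, exists q : O * O, i < theta ->
    [/\ q.1 < lambda, q.2 < kappa, p q.2 = (eta, (p q.2).2), p (p q.2).2 = (alpha, i)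
      & ~ positive kappa J (colour_fibre col B q.2 q.1)].
  move=> i; have [i_theta|i_theta] := pselect (i < theta); last by exists (i, i).
  have [w wk pw] := pP alpha i alphak (lt_le_trans i_theta tk).
  have [z zk pz] := pP eta w etak wk.
  apply: contrapT => nq; apply: nz; exists z => // y yl; apply: contrapT => npos.
  by apply: nq; exists (y, z) => _; rewrite pz.
have ql i : i < theta -> (q i).1 < lambda by move=> /qP[].
have [a al aq] := succ_sup O_wo theta_infinite lambda_succ ql.
(* A label [x] above all missed colours with a positive fibre: at its own coordinate [i] every
   colour below [x] is attained, including the missed one. *)
have [x [xl xpos] ax] := otp_cofinal etaP al.
have [itt ita] := proj2 (itP x) xpos; set i := (it x).1 in itt ita.
have [_ zk pz pw npos] := qP i itt; apply: npos.
have [y yt ey] := eP x xl (q i).1 (lt_le_trans (aq i itt) ax).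
have [a' a't a'g] := gP x xl.
have [|e' e'pos ye'] :=
    alphaP [set e' | positive kappa J (split_by x i e')] a' a't _ y yt.
  move=> j a'j jt; have [jl jpos] := ita j jt; exists ((it x).2 j) => //.
  by rewrite jl ltW // a'g.
apply: (positive_colour_fibre J_ideal e'pos Bpos) => // [b' [[]]//|b' [[_ _ cx] Ge] _].
by rewrite /col pw pz /= cx Ge ye' ey clipE // ql.
Qed.
End Colourings.

Theorem corollary6p4 (d : Order.disp_t) (O : orderType d)
    (O_wo : wochoice.well_order (fun x y : O => x <= y))
    (theta thetaplus : O) (theta_reg : infinite_regular theta)
    (thetaplus_succ : is_succ_cardinal theta thetaplus) :
  [/\ forall kappa : O, is_bounding_number theta kappa ->
        onto theta (Jbd theta) theta ->
        onto_plus kappa theta (complete_ideals kappa thetaplus) theta,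
      forall kappa : O, is_bounding_number theta kappa -> kappa = thetaplus ->
        onto theta (Jbd theta) theta ->
        onto_plus kappa theta (complete_ideals kappa kappa) kappa,
      forall kappa : O, is_dominating_number theta kappa ->
        onto_plus kappa kappa (complete_ideals kappa thetaplus) theta
    & forall kappa b : O, is_dominating_number theta kappa ->
        is_bounding_number theta b -> thetaplus < b ->
        unbounded_plus kappa kappa
          (complete_ideals kappa thetaplus) thetaplus ->
        onto_plus kappa kappa
          (complete_ideals kappa thetaplus) thetaplus].
Proof.
split.
- exact (bounding_onto O_wo theta_reg thetaplus_succ).
- move=> kappa kb kE; rewrite {kappa}kE in kb *.
  exact (bounding_succ_onto O_wo theta_reg thetaplus_succ kb).
- exact (dominating_onto O_wo theta_reg thetaplus_succ).
- exact (dominating_succ_onto O_wo theta_reg thetaplus_succ).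
Qed.
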